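(* Let $q\ge5$ be a prime power and let $\mathcal{C}_\mathscr{C}$ be the $[q+1,q-3,5]_q$ code with parity check matrix whose columns are the vectors $(1,t,t^2,t^3)$, $t\in\mathbb{F}_q$, and $(0,0,0,1)$. Let $\mathcal{V}^{(2)}$ be a weight-$2$ coset of $\mathcal{C}_\mathscr{C}$. Then $B_0(\mathcal{V}^{(2)})=B_1(\mathcal{V}^{(2)})=0$, $B_2(\mathcal{V}^{(2)})=1$, $B_3(\mathcal{V}^{(2)})=\frac13\binom{q-2}{2}$ if $q\not\equiv1\pmod3$, and $B_3(\mathcal{V}^{(2)})\in\{\frac{q^2-5q+4}{6},\frac{q^2-5q+10}{6}\}$ if $q\equiv1\pmod 3$; $$B_4(\mathcal{V}^{(2)})=\binom{q+1}{4}-\binom{q-1}{2}-(q-2)B_3(\mathcal{V}^{(2)});$$ and for $w\ge5$ $$B_w(\mathcal{V}^{(2)})=A_w(\mathcal{C}_\mathscr{C})+(-1)^{w}\left(\binom{q+1}{w}\binom{w-1}{3}-(w-3)\binom{q-1}{w-2}-\binom{q-2}{w-3}B_3(\mathcal{V}^{(2)})\right).$$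
   Context: A coset of a linear code $\mathcal{C}\subseteq\mathbb{F}_q^n$ is a set $\mathbf{v}+\mathcal{C}$; its weight is the minimum Hamming weight of its vectors. $B_w(\mathcal{V})$ is the number of vectors of Hamming weight $w$ in the coset $\mathcal{V}$, and $A_w(\mathcal{C}_\mathscr{C})$ is the number of codewords of Hamming weight $w$ in $\mathcal{C}_\mathscr{C}$. *)

(* Defs.v *)
From HB Require Import structures.
From mathcomp Require Import all_boot all_order all_algebra.
Set Implicit Arguments. Unset Strict Implicit. Unset Printing Implicit Defensive.
Import GRing.Theory Num.Theory.
Local Open Scope ring_scope.

(* Coordinates of F^(q+1) are indexed by option F:
   Some t  <-> the column (1,t,t^2,t^3),   None <-> the column (0,0,0,1). *)
Definition word (F : finFieldType) := {ffun option F -> F}.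

Definition pcm (F : finFieldType) (k : 'I_4) (i : option F) : F :=
  match i with Some t => t ^+ k | None => (k == 3%N :> nat)%:R end.

Definition CC (F : finFieldType) : {set word F} :=
  [set c : word F | [forall k : 'I_4, \sum_(i : option F) pcm k i * c i == 0]].

Definition wt (F : finFieldType) (x : word F) : nat := #|[set i | x i != 0]|.

Definition coset (F : finFieldType) (v : word F) : {set word F} :=
  [set x : word F | (x - v) \in CC F].

Definition coset_weight_is (F : finFieldType) (v : word F) (w : nat) : Prop :=
  (exists2 x, x \in coset v & wt x = w) /\ (forall x, x \in coset v -> (w <= wt x)%N).

Definition Bw (F : finFieldType) (v : word F) (w : nat) : nat :=
  #|[set x in coset v | wt x == w]|.

Definition Aw (F : finFieldType) (w : nat) : nat :=
  #|[set c in CC F | wt c == w]|.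

(* Main.v *)
(* Write [s, i] for the 2x2 determinant of homogeneous coordinates of two points
   of the projective line.  For three points s1, s2, s3 the cubic form
   [s1, i][s2, i][s3, i] is a combination of the rows of the parity check
   matrix, hence orthogonal to the code; this gives minimum distance 5, and every
   coset then meets the words supported on any set of at least four points in
   as many vectors as the code does.  So the binomial transform of the
   differences B_w - A_w vanishes beyond degree 3, and inverting it expresses
   every B_w - A_w through B_0, ..., B_3.  If the coset leader is supported on
   {a, b}, the supports of its vectors of weight 3 are the triples of points off
   {a, b} along which the coordinate [s, a] / [s, b] has a prescribed product c.
   These coordinates run over the nonzero scalars, so
   6 B_3 = (q - 1)^2 - 3 (q - 1) + 2 k with k the number of cube roots of c. *)
From HB Require Import structures.
From mathcomp Require Import all_boot all_order all_algebra.
From mathcomp Require Import all_fingroup all_solvable all_field.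
From mathcomp Require Import zify ring.
Require Import Defs.
Import GRing.Theory Num.Theory.
Local Open Scope ring_scope.

Set Implicit Arguments.
Unset Strict Implicit.
Unset Printing Implicit Defensive.

(** * The code as the dual of the points of the twisted cubic *)

Section TwistedCubic.

Variable F : finFieldType.
Implicit Types (i j s a b : option F) (x c v : word F) (S T : {set option F}).

(** An option coerces to [true] exactly when it is [Some], so [hcoord0] and [hcoord1] together give
    the point (1 : t) for [Some t] and (0 : 1) for [None]. *)
Definition hcoord0 i : F := (i : bool)%:R.
Definition hcoord1 i : F := if i is Some t then t else 1.
Definition bracket s i : F := hcoord0 s * hcoord1 i - hcoord1 s * hcoord0 i.

(** The columns are the points of the twisted cubic, so a combination of rows is a binary cubic
    form. At [None] the convention 0 ^ 0 = 1 yields the last unit vector. *)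
Lemma pcmE (k : 'I_4) i : pcm k i = hcoord0 i ^+ (3 - k) * hcoord1 i ^+ k.
Proof.
case: i => [t|] /=; first by rewrite /hcoord0 expr1n mul1r.
rewrite /hcoord0 /hcoord1 expr1n mulr1 expr0n; have := ltn_ord k.
case: (nat_of_ord k) => [|[|[|[|m]]]] //.
Qed.

Lemma bracket_eq0 s i : (bracket s i == 0) = (s == i).
Proof.
rewrite /bracket; case: s => [s|]; case: i => [t|]; rewrite /hcoord0 /hcoord1 /=.
- rewrite mul1r mulr1 subr_eq0 eq_sym; by apply/eqP/eqP => [->|[]].
- by rewrite mulr1 mulr0 subr0 oner_eq0.
- by rewrite mul0r sub0r mulr1 oppr_eq0 oner_eq0.
- by rewrite mul0r mulr0 subr0 !eqxx.
Qed.

Lemma bracketxx i : bracket i i = 0.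
Proof. by apply/eqP; rewrite bracket_eq0. Qed.

Definition supp x : {set option F} := [set i | x i != 0].

Lemma suppP x S : reflect (forall i, i \notin S -> x i = 0) (supp x \subset S).
Proof.
apply: (iffP subsetP) => [h i iS|h i].
  by apply/eqP; apply: contraNT iS => xi; apply: h; rewrite inE.
by rewrite inE; apply: contraR => /h ->.
Qed.

Lemma CC_sumP c :
  reflect (forall k : 'I_4, \sum_i pcm k i * c i = 0) (c \in CC F).
Proof. by rewrite inE; apply: (iffP forallP) => h k; apply/eqP. Qed.

Lemma CC0 : (0 : word F) \in CC F.
Proof. by apply/CC_sumP => k; apply: big1 => i _; rewrite ffunE mulr0. Qed.

Lemma CCB c c' : c \in CC F -> c' \in CC F -> c - c' \in CC F.
Proof.
move=> /CC_sumP h /CC_sumP h'; apply/CC_sumP => k.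
transitivity (\sum_i pcm k i * c i - \sum_i pcm k i * c' i).
  by rewrite -sumrB; apply: eq_bigr => i _; rewrite !ffunE mulrBr.
by rewrite h h' subrr.
Qed.

Lemma coset_refl v : v \in coset v.
Proof. by rewrite inE subrr CC0. Qed.

Lemma coset_subr v x x' : x \in coset v -> x' \in coset v -> x - x' \in CC F.
Proof.
rewrite ![_ \in coset _]inE => h h'; have := CCB h h'.
by rewrite opprB addrA subrK.
Qed.

Lemma coset_eq v x : x \in coset v -> coset x = coset v.
Proof.
move=> xv; have xv' := xv; move: xv'; rewrite inE => xv'.
apply/setP => y; apply/idP/idP => [|yv]; last by rewrite inE (coset_subr yv xv).
rewrite ![_ \in coset _]inE => yx.
have -> : y - v = (y - x) - (0 - (x - v)) by rewrite sub0r opprK addrA subrK.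
exact/CCB/CCB/xv'/CC0.
Qed.

(** Expanding the product of three linear forms in [i] gives cubic monomials, whose coefficients are
    the polarized elementary symmetric functions of the three points; each monomial is a row of the
    parity check matrix. *)
Lemma sum_bracket3 c s1 s2 s3 : c \in CC F ->
  \sum_i bracket s1 i * bracket s2 i * bracket s3 i * c i = 0.
Proof.
move=> /CC_sumP h.
have h0 := h (@Ordinal 4 0 isT); have h1 := h (@Ordinal 4 1 isT).
have h2 := h (@Ordinal 4 2 isT); have h3 := h (@Ordinal 4 3 isT).
set u1 := hcoord0 s1; set u2 := hcoord0 s2; set u3 := hcoord0 s3.
set z1 := hcoord1 s1; set z2 := hcoord1 s2; set z3 := hcoord1 s3.
transitivity (u1 * u2 * u3 * (\sum_i pcm (@Ordinal 4 3 isT) i * c i)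
  - (z1 * u2 * u3 + u1 * z2 * u3 + u1 * u2 * z3)
     * (\sum_i pcm (@Ordinal 4 2 isT) i * c i)
  + (z1 * z2 * u3 + z1 * u2 * z3 + u1 * z2 * z3)
     * (\sum_i pcm (@Ordinal 4 1 isT) i * c i)
  - z1 * z2 * z3 * (\sum_i pcm (@Ordinal 4 0 isT) i * c i)); last first.
  by rewrite h0 h1 h2 h3 !mulr0 !subr0 !addr0.
rewrite !mulr_sumr -sumrB -big_split -sumrB; apply: eq_bigr => i _ /=.
rewrite !pcmE /= /bracket -/u1 -/u2 -/u3 -/z1 -/z2 -/z3 /subn /=; ring.
Qed.

Lemma sum_prod_bracket c S : c \in CC F -> #|S| = 3%N ->
  \sum_i (\prod_(s in S) bracket s i) * c i = 0.
Proof.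
move=> cC; rewrite cardE; case E: (enum S) => [|s1 [|s2 [|s3 []]]] // _.
rewrite -[RHS](sum_bracket3 s1 s2 s3 cC); apply: eq_bigr => i _.
have -> : \prod_(s in S) bracket s i = \prod_(s <- enum S) bracket s i.
  by rewrite big_enum.
by rewrite E !big_cons big_nil mulr1 !mulrA.
Qed.

(** If [c i] were nonzero, at most three other points would carry [c]; a cubic form vanishing at
    those but not at [i] leaves a single nonzero term in an orthogonality relation. *)
Lemma CC_wt_le4 c : c \in CC F -> (wt c <= 4)%N -> c = 0.
Proof.
move=> cC w4; apply/ffunP => i; rewrite ffunE; apply/eqP; apply: contraT => ci.
(* As the default of [nth], such a [j] pads a list of fewer than three points without making the
   cubic form vanish at [i]. *)
have [j ij] : exists j, j != i.
  by case: (i) => [t|]; [exists None | exists (Some 0)].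
pose e := enum (supp c :\ i).
have se : (size e <= 3)%N.
  have := w4; rewrite /wt -/(supp c) (cardsD1 i (supp c)) [i \in _]inE ci.
  by rewrite add1n ltnS cardE.
have ne k : nth j e k != i.
  have [ke|ke] := ltnP k (size e); last by rewrite nth_default.
  by have := mem_nth j ke; rewrite mem_enum !inE => /andP[].
have := sum_bracket3 (nth j e 0) (nth j e 1) (nth j e 2) cC.
rewrite (bigD1 i) //= big1 => [|l li].
  move/eqP; rewrite addr0 !mulf_eq0 !bracket_eq0 (negPf ci) orbF.
  by rewrite (negPf (ne 0%N)) (negPf (ne 1%N)) (negPf (ne 2%N)).
have [cl|cl] := eqVneq (c l) 0; first by rewrite cl mulr0.
have le : l \in e by rewrite mem_enum !inE li.
have := nth_index j le; move: (le); rewrite -index_mem => lt.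
case E: (index l e) => [|[|[|k]]] => [->|->|->|_].
- by rewrite bracketxx !mul0r.
- by rewrite bracketxx mulr0 !mul0r.
- by rewrite bracketxx mulr0 !mul0r.
- by have := leq_trans lt se; rewrite E.
Qed.

Lemma supp_sub x x' : supp (x - x') \subset supp x :|: supp x'.
Proof.
apply/suppP => i; rewrite !inE negb_or !negbK !ffunE => /andP[/eqP-> /eqP->].
by rewrite subr0.
Qed.

(** The difference of the two words is a codeword of weight at most 4. *)
Lemma coset_supp_inj v x x' T : x \in coset v -> x' \in coset v ->
  supp x \subset T -> supp x' \subset T -> (#|T| <= 4)%N -> x = x'.
Proof.
move=> xv x'v sx sx' T4; apply/eqP; rewrite -subr_eq0; apply/eqP.
apply: CC_wt_le4; first exact: coset_subr xv x'v.
apply: leq_trans T4; apply: subset_leq_card.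
by apply: subset_trans (supp_sub x x') _; rewrite subUset sx.
Qed.

(* The syndrome map is injective on the words supported on four points, and
   these are as numerous as the syndromes. *)
Lemma coset_supp4 v T : #|T| = 4%N -> exists2 x, x \in coset v & supp x \subset T.
Proof.
move=> T4.
pose syn x : {ffun 'I_4 -> F} := [ffun k => \sum_i pcm k i * x i].
have synB x x' : syn x = syn x' -> x - x' \in CC F.
  move=> e; apply/CC_sumP => k; have := congr1 (fun f : {ffun 'I_4 -> F} => f k) e.
  rewrite !ffunE => /eqP; rewrite -subr_eq0 -sumrB => /eqP e0.
  by rewrite -[RHS]e0; apply: eq_bigr => i _; rewrite !ffunE mulrBr.
pose W := [set x | x \in pffun_on 0 (mem T) (mem F)].
have WP x : (x \in W) = (supp x \subset T).
  rewrite inE; apply/pffun_onP/idP => [[/subsetP h _]|/subsetP h].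
    by apply/subsetP => i; rewrite inE => xi; apply: h.
  by split=> [|//]; apply/subsetP => i xi; apply: h; rewrite inE.
have inj : {in W &, injective syn}.
  move=> x x'; rewrite !WP => sx sx' /synB e.
  apply: (coset_supp_inj (v := x') _ (coset_refl x') sx sx'); last by rewrite T4.
  by rewrite inE.
have full : syn @: W = [set: {ffun 'I_4 -> F}].
  apply/eqP; rewrite eqEcard subsetT card_in_imset // cardsT card_ffun card_ord.
  by rewrite cardsE card_pffun_on T4 leqnn.
have : syn v \in syn @: W by rewrite full inE.
case/imsetP => x; rewrite WP => sx e; exists x => //.
by rewrite inE; apply: synB.
Qed.

Lemma coset_supp_ge4 v T : (4 <= #|T|)%N ->
  exists2 x, x \in coset v & supp x \subset T.
Proof.
move=> T4.
have : (0 < #|[set S : {set option F} | S \subset T & #|S| == 4]|)%N.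
  by rewrite cards_draws bin_gt0.
case/card_gt0P => S; rewrite inE => /andP[ST /eqP S4].
by have [x xv xS] := coset_supp4 v S4; exists x => //; apply: subset_trans ST.
Qed.

End TwistedCubic.

(** * Binomial inversion and the counting of supersets *)

Lemma coef_XaddC_exp (R : comNzRingType) (a : R) (n k : nat) :
  (('X + a%:P) ^+ n)`_k = 'C(n, k)%:R * a ^+ (n - k).
Proof.
rewrite addrC exprDn coef_sum.
rewrite (eq_bigr (fun i : 'I_n.+1 =>
    if i == k :> nat then 'C(n, k)%:R * a ^+ (n - k) else 0)); last first.
  move=> i _; rewrite -polyC_exp coefMn coefCM coefXn eq_sym.
  by case: eqP => [->|_]; rewrite ?mulr1 ?mulr_natl // mulr0 mul0rn.
rewrite -big_mkcond /=; have [kn|nk] := leqP k n; last first.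
  rewrite bin_small // mul0r big_pred0 // => i; apply/negP => /eqP ik.
  by have := ltn_ord i; rewrite ik ltnS leqNgt nk.
have kn' : (k < n.+1)%N by [].
by rewrite (big_pred1 (Ordinal kn')) // => i.
Qed.

(* The transform is the substitution X := X + 1 in the polynomial whose
   coefficients are the D u. *)
Lemma binomial_inversion (R : comNzRingType) (n : nat) (D M : nat -> R) :
  (forall j, M j = \sum_(u < n) D u * 'C(u, j)%:R) ->
  forall w, (w < n)%N -> D w = \sum_(j < n) M j * ('C(j, w)%:R * (-1) ^+ (j - w)).
Proof.
move=> DM w wn; pose P := \poly_(u < n) D u; pose Q := \poly_(j < n) M j.
have PX : P \Po ('X + 1%:P) = Q.
  apply/polyP => j; rewrite coef_poly /P poly_def raddf_sum coef_sum.
  rewrite (eq_bigr (fun u : 'I_n => D u * 'C(u, j)%:R)) => [|u _].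
    have [jn|nj] := ltnP j n; first by rewrite DM.
    by apply: big1 => u _; rewrite bin_small ?mulr0 //; apply: leq_trans nj.
  by rewrite /= comp_polyZ comp_Xn_poly coefZ coef_XaddC_exp expr1n mulr1.
have QX : Q \Po ('X + (-1)%:P) = P.
  by rewrite polyCN -PX comp_polyXaddC_K.
transitivity (P`_w); first by rewrite coef_poly wn.
rewrite -QX /Q poly_def raddf_sum coef_sum; apply: eq_bigr => j _.
by rewrite /= comp_polyZ comp_Xn_poly coefZ coef_XaddC_exp.
Qed.

(** Complements turn supersets of [U] into subsets of [~: U]. With lower index [#|T| - j] the
    binomial is also right, namely 0, when [j < #|U|]. *)
Lemma card_supersets (T : finType) (U : {set T}) (j : nat) : (j <= #|T|)%N ->
  #|[set S : {set T} | U \subset S & #|S| == j]| = 'C(#|T| - #|U|, #|T| - j).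
Proof.
move=> jT; have <- : #|~: U| = (#|T| - #|U|)%N by rewrite cardsCs setCK.
rewrite -cards_draws -(card_imset _ (can_inj (@setCK T))).
apply: eq_card => S; apply/imsetP/idP => [[A]|].
  rewrite !inE => /andP[UA /eqP Aj] ->; rewrite setCS UA /= cardsCs setCK Aj.
  by rewrite eqxx.
rewrite inE => /andP[SU /eqP Sj]; exists (~: S); last by rewrite setCK.
by rewrite inE -setCS setCK SU /= cardsCs setCK Sj subKn.
Qed.

(** * Weight distribution of a coset relative to that of the code *)

Section Weights.

Variable F : finFieldType.
Implicit Types (v x : word F) (S : {set option F}).

Local Notation n := #|F|.+1.

Lemma wt_le x : (wt x <= n)%N.
Proof. by rewrite -card_option max_card. Qed.

(** Double counting of the pairs of a word of [X] and a [j]-set containing its support. *)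
Lemma sum_card_supported (X : {set word F}) (j : nat) : (j <= n)%N ->
  (\sum_(S : {set option F} | #|S| == j) #|[set x in X | supp x \subset S]| =
   \sum_(u < n.+1) #|[set x in X | wt x == u]| * 'C(n - u, n - j))%N.
Proof.
move=> jn.
under eq_bigr => S _ do rewrite -sum1_card.
under eq_bigr => S _ do under eq_bigl => x do rewrite inE.
rewrite (exchange_big_dep (mem X)) /=; last by move=> S x _ /andP[].
transitivity (\sum_(x in X) 'C(n - wt x, n - j))%N.
  apply: eq_bigr => x xX; rewrite -card_option -card_supersets ?card_option //.
  rewrite -sum1_card; apply: eq_bigl => S; rewrite !inE xX andbC //.
rewrite (partition_big (fun x => inord (wt x) : 'I_n.+1) predT) //=.
apply: eq_bigr => u _; rewrite -sum_nat_const; apply: eq_big => [x|x].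
  by rewrite inE -val_eqE /= inordK // ltnS wt_le.
by case/andP => _ /eqP <-; rewrite inordK // ltnS wt_le.
Qed.

Lemma Aw_coset w : Aw F w = Bw (0 : word F) w.
Proof. by rewrite /Aw /Bw; apply: eq_card => x; rewrite !inE subr0. Qed.

(** Translation by a vector of the coset supported on [S] is a bijection between the two sets. *)
Lemma card_supported_coset v S : (4 <= #|S|)%N ->
  #|[set x in coset v | supp x \subset S]| =
  #|[set x in coset (0 : word F) | supp x \subset S]|.
Proof.
move=> S4; have [x0 x0v sx0] := coset_supp_ge4 v S4.
rewrite -(card_imset _ (addrI (- x0))); apply: eq_card => y.
apply/imsetP/idP => [[x /setIdP[xv sx] ->]|/setIdP[]].
  rewrite addrC; apply/setIdP; split.
    by rewrite inE subr0; apply: coset_subr xv x0v.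
  by apply: subset_trans (supp_sub _ _) _; rewrite subUset sx.
rewrite inE subr0 => yC sy.
exists (y + x0); last by rewrite addrC addrK.
apply/setIdP; split; first by rewrite -(coset_eq x0v) inE addrK.
(* The sum is written as a difference so that [supp_sub] applies. *)
rewrite -[x0]opprK; apply: subset_trans (supp_sub _ _) _; rewrite subUset sy /=.
apply/suppP => i iS; move/suppP/(_ i iS): sx0; rewrite !ffunE => ->.
by rewrite oppr0.
Qed.

Definition weight_diff v (w : nat) : rat := (Bw v w)%:R - (Aw F w)%:R.

Lemma weight_diff_moment v (j : nat) : (4 <= j <= n)%N ->
  \sum_(u < n.+1) weight_diff v u * 'C(n - u, n - j)%:R = 0.
Proof.
case/andP => j4 jn.
under eq_bigr => u _ do rewrite /weight_diff mulrBl -!natrM.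
rewrite sumrB -!natr_sum; apply/eqP; rewrite subr_eq0; apply/eqP; congr (_%:R).
under [RHS]eq_bigr => u _ do rewrite Aw_coset.
rewrite -!sum_card_supported //; apply: eq_bigr => S /eqP Sj.
by apply: card_supported_coset; rewrite Sj.
Qed.

Lemma sum_truncate4 (G : nat -> rat) : (4 <= n)%N ->
  (forall j, (4 <= j <= n)%N -> G j = 0) ->
  \sum_(j < n.+1) G j = \sum_(j < 4) G j.
Proof.
move=> n4 G0; rewrite -!(big_mkord xpredT) (@big_cat_nat _ _ _ 4) //=; last exact: leqW.
have -> : \sum_(4 <= j < n.+1) G j = 0.
  by rewrite big_nat; apply: big1 => j; rewrite ltnS => /G0.
by rewrite addr0.
Qed.

(** Inversion of the moments, of which only those with [j < 4] survive; in these only the terms with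
    [u <= j] are nonzero, so both sums stop at 4. *)
Lemma weight_diffE v w : (4 <= w <= n)%N ->
  weight_diff v w =
    \sum_(j < 4) (\sum_(u < 4) weight_diff v u * 'C(n - u, n - j)%:R)
                 * ('C(n - j, n - w)%:R * (-1) ^+ (w - j)).
Proof.
case/andP => w4 wn; have n4 := leq_trans w4 wn.
(* Indexing by the number of zero coordinates brings the moments into the form of
   [binomial_inversion]. *)
pose D u := weight_diff v (n - u).
pose M j := \sum_(u < n.+1) D u * 'C(u, j)%:R.
have ME j : (j <= n)%N ->
    M (n - j)%N = \sum_(u < n.+1) weight_diff v u * 'C(n - u, n - j)%:R.
  move=> jn; rewrite /M (reindex_inj rev_ord_inj); apply: eq_bigr => u _ /=.
  by rewrite /D subSS subKn // -ltnS.
have := binomial_inversion (M := M) (fun _ => erefl) (w := n - w).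
rewrite ltnS leq_subr => /(_ isT); rewrite {1}/D subKn // => ->.
rewrite (reindex_inj rev_ord_inj) /=.
pose G j := M (n - j)%N * ('C(n - j, n - w)%:R * (-1) ^+ (n - j - (n - w))).
rewrite (eq_bigr (fun j : 'I_n.+1 => G j)) => [|j _]; last by rewrite subSS.
rewrite sum_truncate4 // => [|j j4]; last first.
  by rewrite /G ME ?weight_diff_moment ?mul0r //; case/andP: j4.
apply: eq_bigr => j _; have j4 := ltn_ord j; rewrite /G; congr (_ * (_ * _ ^+ _)).
  rewrite ME; last by lia.
  pose H u := weight_diff v u * 'C(n - u, n - j)%:R.
  rewrite (sum_truncate4 (G := H)) // => u /andP[u4 un].
  by rewrite /H bin_small ?mulr0 //; lia.
by lia.
Qed.

Lemma weight_diff_gt v w : (n < w)%N -> weight_diff v w = 0.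
Proof.
move=> nw; rewrite /weight_diff Aw_coset.
suff B0 v' : Bw v' w = 0%N by rewrite !B0 subrr.
apply/eqP; rewrite cards_eq0; apply/eqP/setP => x; rewrite !inE.
by apply/negP => /andP[_ /eqP xw]; have := wt_le x; rewrite xw leqNgt nw.
Qed.

End Weights.

(** * Cube roots, and triples of distinct nonzero scalars with a given product *)

Section CubeRoots.

Variable F : finFieldType.
Implicit Types x y z c : F.

Definition cube_roots c : {set F} := [set x | x ^+ 3 == c].

Lemma card_nonzero : #|[set x : F | x != 0]| = #|F|.-1.
Proof. by rewrite -(cardC1 (0 : F)) cardsE. Qed.

Lemma expf_card_pred x : x != 0 -> x ^+ #|F|.-1 = 1.
Proof.
move=> x0; apply: (mulfI x0); rewrite -exprS mulr1 prednK ?expf_card //.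
by apply/card_gt0P; exists x.
Qed.

(** Here 3 does not divide the order q - 1 of the multiplicative group, so cubing is injective,
    hence bijective on the finite field. *)
Lemma card_cube_roots_neq1 c : (#|F| %% 3 != 1)%N -> #|cube_roots c| = 1%N.
Proof.
move=> q1.
have q0 : (0 < #|F|)%N by apply/card_gt0P; exists c.
have unity x : x ^+ 3 = 1 -> x = 1.
  move=> x3; have x0 : x != 0.
    by apply: contra_eq_neq x3 => ->; rewrite expr0n /= eq_sym oner_neq0.
  have := expf_card_pred x0.
  rewrite (divn_eq #|F|.-1 3) exprD mulnC exprM x3 expr1n mul1r.
  have [->|->] : (#|F|.-1 %% 3 = 1 \/ #|F|.-1 %% 3 = 2)%N by lia.
    by rewrite expr1.
  by move=> x2; move: x3; rewrite exprS x2 mulr1.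
have inj : injective (fun x => x ^+ 3).
  move=> x y /= xy; have [y0|y0] := eqVneq y 0.
    by apply/eqP; move/eqP: xy; rewrite y0 expr0n expf_eq0.
  have /unity/(canRL (mulfVK y0)) : (x / y) ^+ 3 = 1.
    by rewrite expr_div_n xy divff // expf_neq0.
  by rewrite mul1r.
have [g gK Kg] := injF_bij inj.
rewrite -(cards1 (g c)); apply: eq_card => x; rewrite !inE.
by apply/eqP/eqP => [<-|->].
Qed.

(** Now 3 divides q - 1, and Cauchy's theorem provides a primitive cube root of unity [w]; one root
    [x] then yields exactly [x], [x * w], [x * w ^+ 2]. *)
Lemma card_cube_roots_eq1 c : (#|F| %% 3 = 1)%N -> c != 0 ->
  #|cube_roots c| = 0%N \/ #|cube_roots c| = 3%N.
Proof.
move=> q1 c0; have [->|[x]] := set_0Vmem (cube_roots c); first by rewrite cards0; left.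
rewrite inE => /eqP xc; right.
have x0 : x != 0 by apply: contraNneq c0 => x0; rewrite -xc x0 expr0n.
have dvd3 : (3 %| #|[set: {unit F}]|)%N.
  rewrite card_finField_unit; have : (0 < #|F|)%N by apply/card_gt0P; exists c.
  by lia.
have [u _ u3] := Cauchy (isT : prime 3) dvd3.
pose w := val u; have w3 : w ^+ 3 = 1 by rewrite -FinRing.val_unitX -u3 expg_order.
have w1 : w != 1.
  apply: contra_eqN u3 => /eqP w1.
  by have -> : u = 1%g by [apply: val_inj]; rewrite order1.
have w_sum : w ^+ 2 + w + 1 = 0.
  apply: (mulfI (x := w - 1)); first by rewrite subr_eq0.
  transitivity (w ^+ 3 - 1); first by ring.
  by rewrite w3 subrr mulr0.
have w0 : w != 0.
  by apply: contra_eq_neq w3 => ->; rewrite expr0n /= eq_sym oner_neq0.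
have -> : cube_roots c = [set x; x * w; x * w ^+ 2].
  apply/setP => y; rewrite !inE -xc -subr_eq0.
  have -> : y ^+ 3 - x ^+ 3 = (y - x) * ((y - x * w) * (y - x * w ^+ 2)).
    transitivity (y ^+ 3 - (w ^+ 2 + w + 1) * (x * y ^+ 2)
                  + (w ^+ 2 + w + 1) * (w * x ^+ 2 * y) - w ^+ 3 * x ^+ 3).
      by rewrite w_sum w3; ring.
    by ring.
  by rewrite !mulf_eq0 !subr_eq0 orbA.
have e2 : x != x * w by rewrite -{1}[x]mulr1 (inj_eq (mulfI x0)) eq_sym.
have e3 : x * w != x * w ^+ 2.
  by rewrite (inj_eq (mulfI x0)) expr2 -{1}[w]mulr1 (inj_eq (mulfI w0)) eq_sym.
have e4 : x * w ^+ 2 != x.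
  rewrite -{2}[x]mulr1 (inj_eq (mulfI x0)); apply: contra_neq w1 => w2.
  by rewrite -w3 exprS w2 mulr1.
by rewrite setUC cardsU1 cards2 !inE e2 negb_or e4 eq_sym e3.
Qed.

(** For nonzero [c], these are the first two entries of the ordered triples of distinct nonzero
    scalars with product [c]: the third entry is c / (xy), and the last two conditions keep it
    different from x and from y. *)
Definition triple_pairs c : {set F * F} :=
  [set p | [&& p.1 != 0, p.2 != 0, p.1 != p.2, p.1 ^+ 2 * p.2 != c
             & p.1 * p.2 ^+ 2 != c]].

(** Inclusion and exclusion over the three possible coincidences. Each has q - 1 pairs, and any two
    of them force all three entries to be equal, that is, to be a cube root of [c]. *)
Lemma card_triple_pairs c : c != 0 ->
  (#|triple_pairs c| + 3 * #|F|.-1 = #|F|.-1 ^ 2 + 2 * #|cube_roots c|)%N.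
Proof.
move=> c0; pose Fx := [set x : F | x != 0].
(* [A], [B] and [C] collect the pairs whose first entry equals the second, whose first equals the
   third, and whose second equals the third. *)
pose A := [set (x, x) | x in Fx].
pose B := [set (x, c / x ^+ 2) | x in Fx].
pose C := [set (c / y ^+ 2, y) | y in Fx].
have AE p : (p \in A) = (p.1 != 0) && (p.1 == p.2).
  case: p => x y; apply/imsetP/andP => /= [[z]|[x0 /eqP <-]].
    by rewrite inE => z0 [-> ->].
  by exists x; rewrite ?inE.
have BE p : (p \in B) = [&& p.1 != 0, p.2 != 0 & p.1 ^+ 2 * p.2 == c].
  case: p => x y; apply/imsetP/and3P => /= [[z]|[x0 y0 /eqP <-]].
    rewrite inE => z0 [-> ->]; have z2 : z ^+ 2 != 0 by rewrite sqrf_eq0.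
    by split=> //; rewrite ?[_ ^+ 2 * _]mulrC ?divfK ?mulf_neq0 ?invr_neq0.
  by exists x; rewrite ?inE // mulrC mulKf // sqrf_eq0.
have CE p : (p \in C) = [&& p.1 != 0, p.2 != 0 & p.1 * p.2 ^+ 2 == c].
  case: p => x y; apply/imsetP/and3P => /= [[z]|[x0 y0 /eqP <-]].
    rewrite inE => z0 [-> ->]; have z2 : z ^+ 2 != 0 by rewrite sqrf_eq0.
    by split=> //; rewrite ?divfK ?mulf_neq0 ?invr_neq0.
  by exists y; rewrite ?inE // mulfK // sqrf_eq0.
have cA : #|A| = #|F|.-1 by rewrite card_imset ?card_nonzero // => x y [].
have cB : #|B| = #|F|.-1 by rewrite card_imset ?card_nonzero // => x y [].
have cC : #|C| = #|F|.-1 by rewrite card_imset ?card_nonzero // => x y [].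
pose K := [set (x, x) | x in cube_roots c].
have cK : #|K| = #|cube_roots c| by rewrite card_imset // => x y [].
have KE x y : ((x, y) \in K) = (x ^+ 3 == c) && (x == y).
  apply/imsetP/andP => /= [[z]|[x3 /eqP <-]].
    by rewrite inE => z3 [-> ->].
  by exists x; rewrite ?inE.
have nz x : x ^+ 3 == c -> x != 0.
  by move/eqP => xc; apply: contraNneq c0 => x0; rewrite -xc x0 expr0n.
have AB : A :&: B = K.
  apply/setP => -[x y]; rewrite inE AE BE KE /=.
  have [<-|] := eqVneq x y; rewrite ?andbF // !andbT -exprSr.
  by case: (boolP (_ == c)) => [/nz->|]; rewrite ?andbF.
have AC : A :&: C = K.
  apply/setP => -[x y]; rewrite inE AE CE KE /=.
  have [<-|] := eqVneq x y; rewrite ?andbF // !andbT -exprS.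
  by case: (boolP (_ == c)) => [/nz->|]; rewrite ?andbF.
have BC : B :&: C = K.
  apply/setP => -[x y]; rewrite inE BE CE KE /=.
  apply/andP/andP => [[/and3P[x0 y0 /eqP xc] /and3P[_ _ /eqP yc]]|[xc /eqP <-]].
    have xy : x = y.
      apply: (mulfI (mulf_neq0 x0 y0)).
      by transitivity c; [rewrite -xc | rewrite -yc]; ring.
    by rewrite -xc xy -exprSr !eqxx.
  by rewrite nz // -exprS -exprSr xc.
have -> : triple_pairs c = setX Fx Fx :\: (A :|: B :|: C).
  apply/setP => -[x y]; rewrite !inE AE BE CE /=.
  by case: (x != 0); case: (y != 0); rewrite ?andbF //= !negb_or !andbT !andbA.
have sub : A :|: B :|: C \subset setX Fx Fx.
  apply/subsetP => -[x y]; rewrite !inE AE BE CE /= -orbA => /or3P[].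
  - by case/andP=> x0 /eqP <-; rewrite x0.
  - by case/and3P=> -> ->.
  - by case/and3P=> -> ->.
have := cardsID (A :|: B :|: C) (setX Fx Fx).
rewrite (setIidPr sub) cardsX !card_nonzero.
have := cardsUI (A :|: B) C; rewrite setIUl AC BC setUid cK cC.
have := cardsUI A B; rewrite AB cK cA cB expnS expn1.
by move: #|_ :\: _| #|A :|: B :|: C| #|A :|: B| #|cube_roots c| #|F|.-1; lia.
Qed.

End CubeRoots.

(** * From ordered to unordered triples of points *)

Section Triples.

Variables (F : finFieldType) (T : finType) (D : {set T}) (r : T -> F) (c : F).

Definition prod_triples : {set {set T}} :=
  [set S : {set T} | [&& S \subset D, #|S| == 3 & \prod_(s in S) r s == c]].

Definition prod_inj3 : {set {ffun 'I_3 -> T}} :=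
  [set f : {ffun 'I_3 -> T} |
    [&& injectiveb f, [forall i, f i \in D] & \prod_i r (f i) == c]].

(** Each 3-set is the image of 3! injections from ['I_3], and the product does not depend on the
    ordering. *)
Lemma card_prod_inj3 : #|prod_inj3| = (#|prod_triples| * 6)%N.
Proof.
have im f S : f \in prod_inj3 -> f @: setT = S -> S \in prod_triples.
  rewrite !inE => /and3P[/injectiveP f_inj /forallP fD fc] <-; apply/and3P; split.
  - by apply/subsetP => _ /imsetP[i _ ->].
  - by rewrite card_imset // cardsT card_ord.
  - rewrite big_imset => [|i j _ _ /f_inj] //=.
    by rewrite (eq_bigl xpredT) // => i; rewrite inE.
rewrite -sum1_card.
rewrite (partition_big (fun f : {ffun 'I_3 -> T} => f @: setT) (mem prod_triples)) /=;
  last by move=> f fP; apply: im fP erefl.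
rewrite -sum_nat_const; apply: eq_bigr => S SP.
have := SP; rewrite inE => /and3P[SD /eqP S3 Sc].
transitivity (#|S| ^_ #|'I_3|)%N; last by rewrite S3 card_ord.
rewrite -(card_inj_ffuns_on _ (mem S)) -sum1_card; apply: eq_bigl => f.
apply/andP/idP => [[]|].
  rewrite !inE => /and3P[f_inj _ _] /eqP <-; rewrite f_inj andbT.
  by apply/ffun_onP => i; apply: imset_f.
rewrite inE => /andP[/ffun_onP fS /injectiveP f_inj].
have fSE : f @: setT = S.
  apply/eqP; rewrite eqEcard card_imset // cardsT card_ord S3 leqnn andbT.
  by apply/subsetP => _ /imsetP[i _ ->]; apply: fS.
split; last exact/eqP.
rewrite inE; apply/and3P; split; first exact/injectiveP.
  by apply/forallP => i; apply: (subsetP SD); apply: fS.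
move: Sc; rewrite -fSE big_imset => [|i j _ _ /f_inj] //=.
by rewrite (eq_bigl xpredT) // => i; rewrite inE.
Qed.

Hypothesis r_inj : {in D &, injective r}.
Hypothesis r_im : r @: D = [set x | x != 0].
Hypothesis c_neq0 : c != 0.

(** The values of [r] at the first two points determine the third value through the product, and [r]
    is a bijection onto the nonzero scalars. *)
Lemma card_prod_triples : (#|prod_triples| * 6 = #|triple_pairs c|)%N.
Proof.
have rD s : s \in D -> r s != 0.
  by move=> sD; have : r s \in r @: D by [apply: imset_f]; rewrite r_im inE.
have Dr x : x != 0 -> exists2 s, s \in D & r s = x.
  move=> x0; have : x \in r @: D by rewrite r_im inE.
  by case/imsetP => s sD ->; exists s.
pose i0 : 'I_3 := @Ordinal 3 0 isT; pose i1 : 'I_3 := @Ordinal 3 1 isT.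
pose i2 : 'I_3 := @Ordinal 3 2 isT.
have i3P (P : 'I_3 -> Prop) : P i0 -> P i1 -> P i2 -> forall i, P i.
  move=> p0 p1 p2 [[|[|[|//]]] lt].
  - by rewrite (_ : Ordinal lt = i0) //; apply: val_inj.
  - by rewrite (_ : Ordinal lt = i1) //; apply: val_inj.
  - by rewrite (_ : Ordinal lt = i2) //; apply: val_inj.
have prod3 (G : 'I_3 -> F) : \prod_i G i = G i0 * G i1 * G i2.
  rewrite !big_ord_recl big_ord0 mulr1 mulrA.
  by congr (G _ * G _ * G _); apply: val_inj.
pose h (f : {ffun 'I_3 -> T}) := (r (f i0), r (f i1)).
rewrite -card_prod_inj3.
have h_inj : {in prod_inj3 &, injective h}.
  move=> f g; rewrite !inE prod3 => /and3P[_ /forallP fD /eqP fc].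
  rewrite prod3 => /and3P[_ /forallP gD /eqP gc] [e0 e1].
  apply/ffunP; apply: (i3P _); apply: r_inj => //.
  apply: (mulfI (mulf_neq0 (rD _ (fD i0)) (rD _ (fD i1)))).
  by rewrite fc -gc e0 e1.
rewrite -(card_in_imset h_inj); apply: eq_card => -[x y].
apply/imsetP/idP => [[f]|].
  rewrite !inE prod3 => /and3P[/injectiveP f_inj /forallP fD /eqP fc] [-> ->] /=.
  have rf_neq i j : i != j -> r (f i) != r (f j).
    by apply: contra_neq => e; apply: f_inj; apply: r_inj.
  rewrite !rD // rf_neq //= -fc; apply/andP; split.
    have -> : r (f i0) ^+ 2 * r (f i1) = r (f i0) * r (f i1) * r (f i0) by ring.
    by rewrite (inj_eq (mulfI _)) ?rf_neq // mulf_neq0 // rD.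
  have -> : r (f i0) * r (f i1) ^+ 2 = r (f i0) * r (f i1) * r (f i1) by ring.
  by rewrite (inj_eq (mulfI _)) ?rf_neq // mulf_neq0 // rD.
rewrite inE => /and5P[/= x0 y0 xy xc yc].
have xy0 : x * y != 0 by rewrite mulf_neq0.
have [s0 s0D rs0] := Dr _ x0; have [s1 s1D rs1] := Dr _ y0.
have [|s2 s2D rs2] := Dr (c / (x * y)); first by rewrite mulf_neq0 ?invr_neq0.
pose f : {ffun 'I_3 -> T} := [ffun i : 'I_3 => nth s0 [:: s0; s1; s2] i].
have f0 : f i0 = s0 by rewrite ffunE.
have f1 : f i1 = s1 by rewrite ffunE.
have f2 : f i2 = s2 by rewrite ffunE.
have n01 : s0 != s1 by apply: contra_neq xy => e; rewrite -rs0 -rs1 e.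
have n02 : s0 != s2.
  apply: contra_neq xc => e; move: rs2; rewrite -e rs0 => eq_x.
  transitivity (x * (x * y)); first by ring.
  by rewrite {1}eq_x divfK.
have n12 : s1 != s2.
  apply: contra_neq yc => e; move: rs2; rewrite -e rs1 => eq_y.
  transitivity (y * (x * y)); first by ring.
  by rewrite {1}eq_y divfK.
exists f; last by rewrite /h f0 f1 rs0 rs1.
rewrite inE; apply/and3P; split.
- apply/injectiveP; apply: (i3P _); apply: (i3P _); rewrite ?f0 ?f1 ?f2 // => e;
    by move: n01 n02 n12; rewrite e eqxx.
- by apply/forallP; apply: i3P; rewrite ?f0 ?f1 ?f2.
- by rewrite prod3 f0 f1 f2 rs0 rs1 rs2 mulrC divfK.
Qed.

End Triples.

(** * Vectors of weight 3 in a coset with leader supported on two points *)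

Section WeightThree.

Variables (F : finFieldType) (v : word F) (a b : option F).
Hypothesis ab : a != b.
Hypothesis supp_v : supp v = [set a; b].

Implicit Types (s : option F) (x : word F) (S : {set option F}).

(** An affine coordinate on the projective line with its zero at [a] and its pole at [b]. *)
Definition bracket_ratio s : F := bracket s a / bracket s b.

Local Notation D := (~: [set a; b]).

Lemma bracket_plucker s s' :
  bracket s a * bracket s' b - bracket s b * bracket s' a = bracket s s' * bracket a b.
Proof. by rewrite /bracket; ring. Qed.

Lemma bracket_ratio_inj : {in D &, injective bracket_ratio}.
Proof.
move=> s s'; rewrite !inE !negb_or => /andP[sa sb] /andP[s'a s'b] /eqP.
rewrite /bracket_ratio eqr_div ?bracket_eq0 // -subr_eq0 [bracket s' a * _]mulrC.
by rewrite bracket_plucker mulf_eq0 !bracket_eq0 (negPf ab) orbF => /eqP.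
Qed.

(** Injectivity suffices, as [D] has (q + 1) - 2 points, the number of nonzero scalars. *)
Lemma bracket_ratio_im : bracket_ratio @: D = [set x | x != 0].
Proof.
apply/eqP; rewrite eqEcard card_in_imset; last exact: bracket_ratio_inj.
rewrite card_nonzero cardsCs setCK cards2 ab card_option subSS subn1 leqnn andbT.
apply/subsetP => _ /imsetP[s sD ->]; move: sD; rewrite !inE negb_or => /andP[sa sb].
by rewrite mulf_neq0 ?invr_neq0 ?bracket_eq0.
Qed.

Lemma leader_neq0 : (v a != 0) /\ (v b != 0).
Proof.
have va : a \in supp v by rewrite supp_v set21.
have vb : b \in supp v by rewrite supp_v set22.
by move: va vb; rewrite !inE.
Qed.

(** The product prescribed for the coordinates of a triple, obtained by solving the orthogonality
    relation of [prod_ratio_eq]. *)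
Definition chord_coef : F := - v b / v a.

Lemma chord_coef_neq0 : chord_coef != 0.
Proof.
by have [va vb] := leader_neq0; rewrite mulf_neq0 ?invr_neq0 ?oppr_eq0.
Qed.

(** Cubic forms are orthogonal to the code, so the sum is constant on the coset and can be evaluated
    at the leader [v]. *)
Lemma sum_prod_bracket_coset x S : x \in coset v -> #|S| = 3%N ->
  \sum_i (\prod_(s in S) bracket s i) * x i =
  (\prod_(s in S) bracket s a) * v a + (\prod_(s in S) bracket s b) * v b.
Proof.
rewrite inE => xv S3; pose G i := \prod_(s in S) bracket s i.
have : \sum_i G i * x i - \sum_i G i * v i = 0.
  rewrite -[RHS](sum_prod_bracket xv S3) -sumrB.
  by apply: eq_bigr => i _; rewrite !ffunE mulrBr.
move/eqP; rewrite subr_eq0 => /eqP ->.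
rewrite (bigD1 a) //= (bigD1 b) ?[b == a]eq_sym //= big1 ?addr0 // => i /andP[ia ib].
have : i \notin supp v by rewrite supp_v !inE negb_or ia.
by rewrite inE negbK => /eqP ->; rewrite mulr0.
Qed.

Lemma prod_ratio_eq S : S \subset D ->
  (\prod_(s in S) bracket_ratio s == chord_coef) =
  ((\prod_(s in S) bracket s a) * v a + (\prod_(s in S) bracket s b) * v b == 0).
Proof.
move=> SD; have [va _] := leader_neq0.
rewrite /bracket_ratio prodf_div /chord_coef eqr_div //; last first.
  apply/prodf_neq0 => s /(subsetP SD); rewrite !inE negb_or bracket_eq0.
  by case/andP.
by rewrite mulNr addr_eq0 [v b * _]mulrC.
Qed.

Lemma coset_eq_leader x :
  x \in coset v -> (#|supp x :|: [set a; b]| <= 4)%N -> x = v.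
Proof.
move=> xv; apply: (coset_supp_inj xv (coset_refl v) (subsetUl _ _)).
by rewrite supp_v subsetUr.
Qed.

(** A support meeting [[set a; b]] would have a union of at most four points with it, forcing
    [x = v], which has weight 2. *)
Lemma disjoint_supp x : x \in coset v -> wt x = 3%N -> supp x \subset D.
Proof.
move=> xv x3; apply/subsetP => i ix; rewrite in_setC; apply/negP => iv.
have card4 : (#|supp x :|: [set a; b]| <= 4)%N.
  have := cardsUI (supp x) [set a; b]; rewrite cards2 ab [#|supp x|]x3.
  have : (0 < #|supp x :&: [set a; b]|)%N by apply/card_gt0P; exists i; rewrite inE ix.
  by move: #|_ :|: _| #|_ :&: _|; lia.
by move: x3; rewrite (coset_eq_leader xv card4) /wt -/(supp v) supp_v cards2 ab.
Qed.

(** Words of weight 3 are determined by their supports. The form vanishing on the support gives the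
    product condition; conversely, that condition removes [a] from the support of the coset word
    living on [a |: S]. *)
Lemma Bw3_prod_triples : Bw v 3 = #|prod_triples D bracket_ratio chord_coef|.
Proof.
rewrite /Bw -(card_in_imset (f := @supp F)); last first.
  move=> x y /setIdP[xv /eqP x3] /setIdP[yv /eqP y3] xy.
  by apply: (coset_supp_inj xv yv (subxx _)); rewrite ?xy // [#|_|]y3.
apply: eq_card => S; apply/imsetP/idP => [[x /setIdP[xv /eqP x3] ->]|].
  have xD := disjoint_supp xv x3; have sx3 : #|supp x| = 3%N := x3.
  rewrite inE xD sx3 eqxx /= prod_ratio_eq // -(sum_prod_bracket_coset xv sx3).
  apply/eqP/big1 => i _; have [xi|xi] := eqVneq (x i) 0; first by rewrite xi mulr0.
  by rewrite (bigD1 i) ?inE //= bracketxx !mul0r.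
rewrite inE => /and3P[SD /eqP S3]; rewrite prod_ratio_eq // => /eqP S0.
have aS : a \notin S by apply/negP => /(subsetP SD); rewrite !inE eqxx.
have T4 : #|a |: S| = 4%N by rewrite cardsU1 aS S3.
have [x xv xT] := coset_supp4 v T4.
have xa : x a = 0.
  have := sum_prod_bracket_coset xv S3; rewrite S0 (bigD1 a) //=.
  rewrite [X in _ + X]big1 ?addr0.
    move/eqP; rewrite mulf_eq0 => /orP[/prodf_eq0[s sS]|/eqP //].
    by rewrite bracket_eq0 => /eqP sa; rewrite -sa sS in aS.
  move=> i ia; have [iS|iS] := boolP (i \in S).
    by rewrite (bigD1 i) //= bracketxx !mul0r.
  by move/suppP: xT => ->; rewrite ?mulr0 // !inE negb_or ia.
have xS : supp x \subset S.
  apply/suppP => i iS; have [->//|ia] := eqVneq i a.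
  by move/suppP: xT => -> //; rewrite !inE negb_or ia.
(* A smaller weight would make the union with [[set a; b]] have at most four points, so that
   [x = v], contrary to [x a = 0]. *)
have x3 : wt x = 3%N.
  have xle3 : (wt x <= 3)%N by have := subset_leq_card xS; rewrite S3.
  apply/eqP; rewrite eqn_leq xle3 /= leqNgt; apply/negP => x2.
  have card4 : (#|supp x :|: [set a; b]| <= 4)%N.
    have := cardsUI (supp x) [set a; b]; rewrite cards2 ab.
    by move: x2; rewrite /wt -/(supp x); move: #|supp x| #|_ :|: _| #|_ :&: _|; lia.
  by have [va _] := leader_neq0; rewrite -(coset_eq_leader xv card4) xa eqxx in va.
exists x; first by apply/setIdP; rewrite x3.
by apply/eqP; rewrite eq_sym eqEcard xS S3 [#|supp x|]x3.
Qed.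

Lemma Bw3_cube_roots :
  (Bw v 3 * 6 + 3 * #|F|.-1 = #|F|.-1 ^ 2 + 2 * #|cube_roots chord_coef|)%N.
Proof.
rewrite Bw3_prod_triples -card_triple_pairs ?chord_coef_neq0 //.
by rewrite (card_prod_triples bracket_ratio_inj bracket_ratio_im chord_coef_neq0).
Qed.

End WeightThree.

(** * The numbers of vectors of small weight *)

Section SmallWeights.

Variable F : finFieldType.
Implicit Types (v x : word F) (w : nat).

Lemma Bw_coset v v' w : v' \in coset v -> Bw v' w = Bw v w.
Proof. by rewrite /Bw => /coset_eq ->. Qed.

Lemma Aw0 : Aw F 0 = 1%N.
Proof.
rewrite -[RHS](cards1 (0 : word F)); apply: eq_card => x; rewrite inE in_set1.
apply/andP/eqP => [[xC /eqP x0]|->]; first by apply: CC_wt_le4; rewrite ?x0.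
split; first exact: CC0.
by rewrite cards_eq0; apply/eqP/setP => i; rewrite !inE ffunE eqxx.
Qed.

Lemma Aw_small w : (0 < w <= 4)%N -> Aw F w = 0%N.
Proof.
case/andP => w0 w4; apply/eqP; rewrite cards_eq0; apply/eqP/setP => x.
rewrite inE in_set0; apply/negP => /andP[xC /eqP xw].
have x0 : x = 0 by apply: CC_wt_le4; rewrite ?xw.
move: w0; rewrite -xw x0 lt0n => /negP; apply.
by rewrite cards_eq0; apply/eqP/setP => i; rewrite !inE ffunE eqxx.
Qed.

Lemma Bw_lt_weight v w k : coset_weight_is v w -> (k < w)%N -> Bw v k = 0%N.
Proof.
case=> _ wle kw; apply/eqP; rewrite cards_eq0; apply/eqP/setP => x.
rewrite in_set0; apply/negP => /setIdP[/wle + /eqP xk].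
by rewrite xk leqNgt kw.
Qed.

Lemma Bw2_weight2 v : coset_weight_is v 2 -> Bw v 2 = 1%N.
Proof.
case=> -[x xv x2] _; rewrite -[RHS](cards1 x); apply: eq_card => y; rewrite in_set1.
apply/setIdP/eqP => [[yv /eqP y2]|->]; last by rewrite x2.
apply: (coset_supp_inj yv xv (subsetUl _ _) (subsetUr _ _)).
by apply: leq_trans (leq_card_setU _ _) _; rewrite [#|supp y|]y2 [#|supp x|]x2.
Qed.

End SmallWeights.

(** * Binomial identities and the closed form of the weight differences *)

(** An alternating partial sum along a row of Pascal's triangle telescopes. *)
Lemma sum_bin3 w : (4 <= w)%N ->
  1 - w%:R + 'C(w, 2)%:R - 'C(w, 3)%:R = - 'C(w - 1, 3)%:R :> rat.
Proof.
case: w => // w _; rewrite subn1 /= !binS !natrD bin1 -natr1.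
ring.
Qed.

(** Both sides count the chains of a [j]-set inside a [w]-set inside an [n]-set. *)
Lemma bin_mul_sub n w j : (j <= w <= n)%N ->
  ('C(n, n - j) * 'C(n - j, n - w) = 'C(n, w) * 'C(w, j))%N.
Proof.
case/andP=> jw wn; have jn := leq_trans jw wn.
have lem : ('C(n, j) * 'C(n - j, w - j) = 'C(n, w) * 'C(w, j))%N.
  have h1 := bin_fact jn; have h2 := bin_fact wn; have h3 := bin_fact jw.
  have wjnj : (w - j <= n - j)%N by lia.
  have h4 := bin_fact wjnj.
  have e : (n - j - (w - j) = n - w)%N by lia.
  rewrite e in h4.
  have p : (0 < j`! * (w - j)`! * (n - w)`!)%N by rewrite !muln_gt0 !fact_gt0.
  apply/eqP; rewrite -(eqn_pmul2r p); apply/eqP.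
  transitivity (n`!); [rewrite -h1 -h4 | rewrite -h2 -h3]; ring.
rewrite -lem bin_sub //; congr (_ * _)%N.
by rewrite -(@bin_sub (n - j) (w - j)); [congr 'C(_, _)|]; lia.
Qed.

(** The inversion formula is fed with the differences -1, 0, 1 and B_3 in weights 0 to 3, since A_0
    = 1 and A_1 = A_2 = A_3 = 0. *)
Lemma weight_diff_weight2 (F : finFieldType) (v : word F) (w : nat) :
  coset_weight_is v 2 -> (4 <= w)%N ->
  weight_diff v w =
    (-1) ^+ w * ('C(#|F| + 1, w)%:R * 'C(w - 1, 3)%:R
                 - (w%:R - 3%:R) * 'C(#|F| - 1, w - 2)%:R
                 - 'C(#|F| - 2, w - 3)%:R * (Bw v 3)%:R).
Proof.
move=> v2 w4; have q_gt1 := finRing_gt1 F.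
(* Beyond the length there are no words, and all three binomials on the right vanish too. *)
have [nw|wn] := ltnP #|F|.+1 w.
  rewrite weight_diff_gt //; move: #|F| nw q_gt1 => q nw q_gt1.
  rewrite !(@bin_small _ w, @bin_small _ (w - 2), @bin_small _ (w - 3)); [by ring|lia..].
rewrite weight_diffE ?w4 // !big_ord_recl !big_ord0 /= /bump /= !add1n.
have -> : weight_diff v 0 = -1.
  by rewrite /weight_diff Aw0 (Bw_lt_weight v2) // sub0r.
have -> : weight_diff v 1 = 0.
  by rewrite /weight_diff Aw_small // (Bw_lt_weight v2) // subrr.
have -> : weight_diff v 2 = 1.
  by rewrite /weight_diff Aw_small // (Bw2_weight2 v2) subr0.
have -> : weight_diff v 3 = (Bw v 3)%:R by rewrite /weight_diff Aw_small // subr0.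
move: (Bw v 3)%:R => B3; move: #|F| q_gt1 wn => q q_gt1 wn.
(* These turn the contribution of weight 0 into C(q + 1, w) times the alternating sum of
   [sum_bin3]. *)
have b0 := @bin_mul_sub q.+1 w 0; have b1 := @bin_mul_sub q.+1 w 1.
have b2 := @bin_mul_sub q.+1 w 2; have b3 := @bin_mul_sub q.+1 w 3.
have {}b0 := congr1 (fun m => m%:R : rat) (b0 ltac:(lia)).
have {}b1 := congr1 (fun m => m%:R : rat) (b1 ltac:(lia)).
have {}b2 := congr1 (fun m => m%:R : rat) (b2 ltac:(lia)).
have {}b3 := congr1 (fun m => m%:R : rat) (b3 ltac:(lia)).
have s := sum_bin3 w4.
(* Absorption merges the two contributions of weight 2, with total coefficient 1 - (w - 2) = -(w -
   3). *)
have d : ((q - 1) * 'C(q - 2, w - 3) = (w - 2) * 'C(q - 1, w - 2))%N.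
  have := mul_bin_diag (q - 1) (w - 3).
  by have [-> ->] : ((q - 1).-1 = q - 2 /\ (w - 3).+1 = w - 2)%N by lia.
have {}d := congr1 (fun m => m%:R : rat) d.
have e1 : 'C(q.+1 - 2, q.+1 - w) = 'C(q - 1, w - 2).
  by rewrite -(@bin_sub (q - 1) (w - 2)); [congr 'C(_, _)|]; lia.
have e2 : 'C(q.+1 - 3, q.+1 - w) = 'C(q - 2, w - 3).
  by rewrite -(@bin_sub (q - 2) (w - 3)); [congr 'C(_, _)|]; lia.
have e3 : 'C(q.+1 - 2, q.+1 - 3) = (q - 1)%N.
  rewrite (_ : q.+1 - 2 = (q.+1 - 3).+1)%N; last by lia.
  by rewrite binSn; lia.
(* The matrix of the moments is triangular: its entries with [j < u] are 0. *)
rewrite (@bin_small (q.+1 - 1)) ?(@bin_small (q.+1 - 2) (q.+1 - 0)); try lia.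
rewrite (@bin_small (q.+1 - 3) (q.+1 - 0)) ?(@bin_small (q.+1 - 2) (q.+1 - 1)); try lia.
rewrite (@bin_small (q.+1 - 3) (q.+1 - 1)) ?(@bin_small (q.+1 - 3) (q.+1 - 2)); try lia.
rewrite !subn0 in b0 b1 b2 b3 *.
rewrite e1 e2 e3 !binn addn1.
rewrite !natrM bin0 bin1 !binn in b0 b1 b2 b3 d.
have sg j : (j <= w)%N -> (-1) ^+ (w - j) = (-1) ^+ w * (-1) ^+ j :> rat.
  by move=> jw; rewrite -{2}(subnK jw) exprD -mulrA -expr2 sqrr_sign mulr1.
rewrite !sg; try lia.
have w2 : (w - 2)%:R = w%:R - 2%:R :> rat by rewrite natrB //; lia.
rewrite w2 in d.
rewrite e1 in b2; rewrite e2 in b3.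
set c1 := 'C(q.+1, q.+1 - 1)%:R in b1 *; set c2 := 'C(q.+1, q.+1 - 2)%:R in b2 *.
set c3 := 'C(q.+1, q.+1 - 3)%:R in b3 *.
set y0 := 'C(q.+1, q.+1 - w)%:R in b0 *.
set y1 := 'C(q.+1 - 1, q.+1 - w)%:R in b1 *.
set y2 := 'C(q - 1, w - 2)%:R in b2 d *; set y3 := 'C(q - 2, w - 3)%:R in b3 d *.
transitivity ((-1) ^+ w * (c1 * y1 - 1 * y0 - c2 * y2 + c3 * y3 + y2
                           - (q - 1)%:R * y3 - B3 * y3)); first by ring.
(* The double sign exposes the right side of [s], which is then rewritten backwards. *)
rewrite b0 b1 b2 b3 d (_ : 'C(w - 1, 3)%:R = - - 'C(w - 1, 3)%:R); last first.
  by rewrite opprK.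
by rewrite -s; ring.
Qed.

(** * Assembly of the weight distribution *)

Unset Implicit Arguments.

Theorem theorem4p3 (F : finFieldType) (v : word F) :
  (5 <= #|F|)%N ->
  coset_weight_is v 2 ->
  let q := #|F| in
  let B3 : rat := (Bw v 3)%:R in
  [/\ Bw v 0 = 0%N, Bw v 1 = 0%N & Bw v 2 = 1%N] /\
  [/\
      (q %% 3 != 1)%N -> B3 = 3%:R^-1 * ('C(q - 2, 2))%:R,
      (q %% 3 = 1)%N ->
        B3 = ((q%:R) ^+ 2 - 5%:R * q%:R + 4%:R) / 6%:R
        \/ B3 = ((q%:R) ^+ 2 - 5%:R * q%:R + 10%:R) / 6%:R,
      (Bw v 4)%:R = ('C(q + 1, 4))%:R - ('C(q - 1, 2))%:R - (q%:R - 2%:R) * B3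
    & forall w : nat, (5 <= w)%N ->
        (Bw v w)%:R = (Aw F w)%:R
          + (-1) ^+ w * (('C(q + 1, w))%:R * ('C(w - 1, 3))%:R
                         - (w%:R - 3%:R) * ('C(q - 1, w - 2))%:R
                         - ('C(q - 2, w - 3))%:R * B3)].
Proof.
move=> q5 v2 q B3.
have [k [kneq1 keq1 k_eq]] : exists k, [/\ (q %% 3 != 1)%N -> k = 1%N,
    (q %% 3 = 1)%N -> k = 0%N \/ k = 3%N
  & (Bw v 3 * 6 + 3 * q.-1 = q.-1 ^ 2 + 2 * k)%N].
  (* The given [v] need not have weight 2, so it is replaced by a leader [x] of its coset. *)
  have [[x xv x2] _] := v2; have /eqP/cards2P[a [b [ab sx]]] : #|supp x| = 2%N := x2.
  exists #|cube_roots (chord_coef x a b)|; split.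
  - exact: card_cube_roots_neq1.
  - by move=> q1; apply: card_cube_roots_eq1 => //; apply: chord_coef_neq0 sx.
  - by rewrite -(Bw_coset 3 xv); apply: Bw3_cube_roots ab sx.
have q_pred : q.-1%:R = q%:R - 1 :> rat by rewrite -subn1 natrB // (leq_trans _ q5).
have {}k_eq : B3 = (q%:R ^+ 2 - 5%:R * q%:R + 4%:R + 2%:R * k%:R) / 6%:R.
  have := congr1 (fun m => m%:R : rat) k_eq.
  rewrite natrD (natrD _ (q.-1 ^ 2)) !natrM q_pred => e; apply: (mulIf (x := 6%:R)) => //.
  by rewrite divfK // -/B3; apply: (addIr (3%:R * (q%:R - 1))); rewrite e; ring.
have formula w := weight_diff_weight2 (w := w) v2.
split; first by split; rewrite ?(Bw2_weight2 v2) ?(Bw_lt_weight v2).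
split.
(* With k = 1 the numerator is q^2 - 5q + 6 = (q - 2)(q - 3). *)
- move=> /kneq1 k1; rewrite k_eq k1.
  have bq : 'C(q - 2, 2)%:R * 2%:R = (q%:R - 2%:R) * (q%:R - 3%:R) :> rat.
    have := congr1 (fun m => m%:R : rat) (mul_bin_diag (q - 2) 1).
    rewrite bin1 -subn1 -subnDA !natrM !natrB ?(leq_trans _ q5) // => ->.
    by rewrite mulrC.
  apply: (mulIf (x := 6%:R)) => //; rewrite divfK //.
  transitivity ('C(q - 2, 2)%:R * 2%:R : rat); first by rewrite bq; ring.
  by field.
- by move=> /keq1[] k1; [left|right]; rewrite k_eq k1; congr (_ / _); ring.
(* Weight 4 is the general formula with A_4 = 0. *)
- have := formula 4%N isT; rewrite /weight_diff Aw_small // subr0 => ->.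
  rewrite -/q -/B3 (binn 3) (bin1 (q - 2)).
  by rewrite (natrB _ (leq_trans _ q5 : (2 <= q)%N)) //; ring.
- by move=> w w5; rewrite -formula ?(leq_trans _ w5) // /weight_diff addrC subrK.
Qed.
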